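(* Let $k,r,m$ be positive integers, $u_i=k+(i-1)r$ for $1\le i\le m$, and fix $p\in[0,1]$. For $\pi\in[u_m]^m$ run the probabilistic parking protocol with parameter $p$ on a street with spots $1,\dots,u_m$, and let $V$ be the event that all $m$ cars park and the occupied spots $s_1<\dots<s_m$ satisfy $s_i\le u_i$ for all $i$. Then $$\sum_{\pi\in[u_m]^m}\mathbb E\big[x^{\mathrm{unl}}\,y^{\mathrm{rep}(\pi)}\,\mathbf 1_V\big]=k\prod_{i=1}^{m-1}\big(xy+(i-1)x+k+mr-i\big).$$
   Context: Probabilistic parking protocol with parameter $p$: cars $1,\dots,m$ arrive in order; a car parks in its preferred spot if unoccupied, otherwise flips an independent coin and with probability $p$ parks in the first unoccupied spot with larger label, with probability $1-p$ in the first unoccupied spot with smaller label, failing to park if there is none in the chosen direction. $\mathrm{unl}$ is the number of cars parking in a spot different from their preference. $\mathrm{rep}(\pi)=\#\{2\le i\le m:\pi_i=\pi_{i-1}\}$. For $p=1$, $V$ is the deterministic event that $\pi$ is an $(r,k)$-parking function, i.e. its increasing rearrangement $\lambda$ satisfies $\lambda_i\le u_i$. *)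

(* Defs.v *)
From HB Require Import structures.
From mathcomp Require Import all_boot all_order all_algebra.

Set Implicit Arguments.
Unset Strict Implicit.
Unset Printing Implicit Defensive.

Import GRing.Theory Num.Theory.

(* Spots and preferences are natural numbers, labelled from 1 as on the street;
   the street with n spots is iota 1 n. *)

Definition first_larger (n : nat) (occ : seq nat) (s : nat) : option nat :=
  ohead [seq t <- iota 1 n | (s < t) && (t \notin occ)].

(* A car driving backwards from s meets the smaller labels in decreasing
   order, hence the reversal. *)
Definition first_smaller (n : nat) (occ : seq nat) (s : nat) : option nat :=
  ohead [seq t <- rev (iota 1 n) | (t < s) && (t \notin occ)].

(* The coin c is true when the car is to drive towards larger labels; it is
   ignored when the preferred spot s is free. None means failure to park. *)
Definition park_car (n : nat) (occ : seq nat) (s : nat) (c : bool) :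
    option nat :=
  if s \notin occ then Some s
  else if c then first_larger n occ s else first_smaller n occ s.

(* The results of the successive cars. A car that fails leaves the street
   unchanged. *)
Fixpoint park (n : nat) (occ : seq nat) (prefs : seq nat) (coins : seq bool) :
    seq (option nat) :=
  match prefs, coins with
  | s :: prefs', c :: coins' =>
      let o := park_car n occ s c in
      o :: park n (if o is Some t then t :: occ else occ) prefs' coins'
  | _, _ => [::]
  end.

Definition outcome (n : nat) (prefs : seq nat) (coins : seq bool) :
    seq (option nat) :=
  park n [::] prefs coins.

Definition unl (prefs : seq nat) (out : seq (option nat)) : nat :=
  count (fun q => if q.2 is Some t then t != q.1 else false) (zip prefs out).

(* The index is 0-based here: entry i of the sequence is the preference of
   car i.+1. *)
Definition rep (prefs : seq nat) : nat :=
  \sum_(1 <= i < size prefs) (nth 0 prefs i == nth 0 prefs i.-1).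

(* u_i, meant for i >= 1. *)
Definition u (k r i : nat) : nat := k + i.-1 * r.

Definition occupied (out : seq (option nat)) : seq nat :=
  sort leq (pmap id out).

Definition eventV (k r : nat) (out : seq (option nat)) : bool :=
  all isSome out &&
  [forall i : 'I_(size out), nth 0 (occupied out) i <= u k r i.+1].

(* An element of [n]^m is given by an m-tuple over 'I_n, whose entry j stands
   for the label j.+1. *)
Definition labels (n m : nat) (a : m.-tuple 'I_n) : seq nat :=
  [seq (nat_of_ord j).+1 | j <- a].

Local Open Scope ring_scope.

(* One independent coin per car, true with probability p; a car that finds
   its preferred spot free does not look at its coin. *)
Definition coins_prob (R : realFieldType) (m : nat) (p : R)
    (c : m.-tuple bool) : R :=
  \prod_(i < m) (if tnth c i then p else 1 - p).

Definition expectation (R : realFieldType) (m : nat) (p : R)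
    (f : m.-tuple bool -> R) : R :=
  \sum_(c : m.-tuple bool) coins_prob p c * f c.

(* Main.v *)
Require Import Defs.
From HB Require Import structures.
From mathcomp Require Import all_boot all_order all_algebra.
From mathcomp Require Import zify ring.

(* Pollak's circle argument, carried out for each fixed sequence of coins.
   Park the cars on a circle with N = k + m r spots, where no car ever fails.
   A car whose predecessors occupy j spots prefers a free one in N - j ways;
   of the j occupied ones, exactly one repeats the previous preference, since
   that spot is always occupied by then.  So the weights over all preferences
   on the circle add up to N prod_j (x y + (j - 1) x + N - j).  Rotating the
   preferences rotates the occupied set and keeps the weight, and by the cycle
   lemma exactly k of the N rotations of a set of m spots satisfy
   s_i <= u_i for all i.  Such a set leaves the last r spots empty, so no car
   crossed the cut and the circle behaves as the street. *)

Set Implicit Arguments.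
Unset Strict Implicit.
Unset Printing Implicit Defensive.

Import Order.TTheory GRing.Theory Num.Theory.
Local Open Scope ring_scope.

(** * Running minima and the cycle lemma *)

Fixpoint running_min (H : nat -> int) (t : nat) : int :=
  if t is t'.+1 then Num.min (running_min H t') (H t) else H 0.

Lemma running_min_le H s t : (s <= t)%N -> running_min H t <= H s.
Proof.
elim: t => [|t IHt] /=; first by rewrite leqn0 => /eqP ->.
rewrite ge_min leq_eqVlt ltnS => /orP[/eqP ->|/IHt ->] //.
by rewrite lexx orbT.
Qed.

Lemma running_min_attained H t :
  exists2 s, (s <= t)%N & running_min H t = H s.
Proof.
elim: t => [|t [s le_st min_s]] /=; first by exists 0.
by case: leP => _; [exists s => //; apply: leqW | exists t.+1].
Qed.

(** Since [H t] is at least the old minimum and [H] falls by at most 1, a new strict minimum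
    undercuts the old one by exactly 1. *)
Lemma running_min_step H t : H t - 1 <= H t.+1 ->
  running_min H t - running_min H t.+1
    = ([forall s : 'I_t.+1, H t.+1 < H s] : nat)%:Z.
Proof.
move=> stepH; have [s le_st min_s] := running_min_attained H t.
have le_t := running_min_le H (leqnn t).
rewrite /=; case: leP => cmp.
  rewrite subrr; case: forallP => // /(_ (Ordinal (le_st : (s < t.+1)%N))) /=.
  by rewrite -min_s; lia.
have -> : [forall s : 'I_t.+1, H t.+1 < H s].
  by apply/forallP => i; apply: lt_le_trans cmp _; apply: running_min_le;
     rewrite -ltnS.
by lia.
Qed.

(** From index [N] on, the values up to [t + N] are those up to [t] lowered by [k]. The indices
    below [N] are at most [t], so their values are no smaller than the minimum up to [t]. *)
Lemma running_min_shift (N k : nat) (H : nat -> int) t : (N <= t.+1)%N ->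
  (forall j, H (j + N)%N = H j - k%:Z) ->
  running_min H (t + N) = running_min H t - k%:Z.
Proof.
move=> le_Nt shiftH; apply/le_anti/andP; split.
  have [s le_st ->] := running_min_attained H t.
  by rewrite -shiftH; apply: running_min_le; rewrite leq_add2r.
have [s le_st ->] := running_min_attained H (t + N).
have [lt_sN|le_Ns] := ltnP s N.
  have : running_min H t <= H s by apply: running_min_le; lia.
  by lia.
rewrite -(subnK le_Ns) shiftH lerD2r; apply: running_min_le; lia.
Qed.

(* By periodicity z is counted exactly when H has a strict record low at
   z + N; records are the steps of the running minimum, which loses k over a
   period. *)
Lemma cycle_lemma (N k : nat) (H : nat -> int) : (0 < N)%N ->
  (forall t, H t - 1 <= H t.+1) -> (forall t, H (t + N)%N = H t - k%:Z) ->
  (\sum_(z < N) [forall t : 'I_N, (H (z + N)%N < H (z + t)%N)%R])%N = k.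
Proof.
case: N => // N _ stepH shiftH.
have record z : (z < N.+1)%N ->
    [forall t : 'I_N.+1, H (z + N.+1)%N < H (z + t)%N]
    = [forall s : 'I_(z + N).+1, H (z + N).+1 < H s].
  move=> lt_zN; apply/forallP/forallP => [rec s | rec t]; last first.
    have lt_t : (z + t < (z + N).+1)%N by move: (ltn_ord t); lia.
    by rewrite addnS; apply: (rec (Ordinal lt_t)).
  have [le_zs|lt_sz] := leqP z s.
    have lt_s : (s - z < N.+1)%N by move: (ltn_ord s); lia.
    by have /= := rec (Ordinal lt_s); rewrite subnKC ?addnS.
  (* An index [s] before the window is moved one period ahead into it; there [H] is lower by [k], so
     the comparison is at least as strong. *)
  have lt_s : (s + N.+1 - z < N.+1)%N by lia.
  have /= := rec (Ordinal lt_s); rewrite subnKC; last by lia.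
  rewrite (shiftH s) addnS.
  by move/lt_le_trans; apply; rewrite gerBl.
apply: (can_inj absz_nat); rewrite -natz natr_sum.
under eq_bigr => z _ do rewrite natz record // -running_min_step //.
have tele := telescope_sumr (fun z => - running_min H (z + N)) (leq0n N.+1).
rewrite big_mkord in tele.
under eq_bigr => z _ do rewrite -[running_min H (_ + _)%N]opprK addrC.
by rewrite tele add0n addSnnS (running_min_shift _ shiftH) //; lia.
Qed.

(** * Rotations of a set of spots *)

Lemma nth_sort_leq (s : seq nat) i b : (i < size s)%N ->
  (nth 0 (sort leq s) i <= b)%N = (i < count (leq^~ b) s)%N.
Proof.
move=> lt_i; have sorted_s : sorted leq (sort leq s) := sort_sorted leq_total s.
have <- : count (leq^~ b) (sort leq s) = count (leq^~ b) s.
  by apply/permP; rewrite perm_sort.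
apply/idP/idP; last exact: (@nth_count_le _ nat).
apply: contraLR; rewrite -leqNgt -ltnNge => le_i.
by apply: (@nth_count_gt _ nat) => //; rewrite le_i size_sort.
Qed.

Definition label (n : nat) (i : 'I_n) : nat := i.+1.

Definition bounded (k r : nat) (s : seq nat) : bool :=
  [forall i : 'I_(size s), (nth 0 (sort leq s) i <= u k r i.+1)%N].

(** At a threshold [t = k + i * r] the inequality says that more than [i] spots lie below [t], which
    bounds entry [i] of the sorted labels. It then holds up to the next threshold because the count
    is monotone. *)
Lemma bounded_heights (k r n : nat) (s : seq 'I_n) : n = (k + size s * r)%N ->
  (0 < r)%N ->
  bounded k r (map (@label n) s)
    = [forall t : 'I_n, (t < r * count (fun i : 'I_n => i < t)%N s + k)%N].
Proof.
move=> def_n r_gt0.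
have nth_label i : (i < size s)%N ->
    (nth 0 (sort leq (map (@label n) s)) i <= u k r i.+1)%N
      = (i < count (fun j : 'I_n => j < k + i * r)%N s)%N.
  by move=> lt_i; rewrite nth_sort_leq ?size_map // count_map.
apply/forallP/forallP => [bound t | heights [i lt_i]] /=.
  have [lt_tk|le_kt] := ltnP t k; first by rewrite ltn_addl.
  pose i := ((t - k) %/ r)%N.
  have lt_i : (i < size s)%N by rewrite ltn_divLR //; move: (ltn_ord t); lia.
  have lt_i' : (i < size (map (@label n) s))%N by rewrite size_map.
  have /= := bound (Ordinal lt_i'); rewrite nth_label // => many.
  have lt_t : (t < r * i.+1 + k)%N.
    by have := ltn_ceil (t - k) r_gt0; rewrite -/i; lia.
  apply: leq_trans lt_t _; rewrite leq_add2r leq_mul2l.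
  rewrite (leq_trans many) ?orbT //.
  apply: sub_count => j /= /leq_trans; apply.
  by have := leq_trunc_div (t - k) r; rewrite -/i; lia.
rewrite size_map in lt_i; rewrite nth_label //.
have lt_n : (k + i * r < n)%N.
  by rewrite def_n ltn_add2l ltn_mul2r r_gt0.
by have /= := heights (Ordinal lt_n);
   rewrite addnC ltn_add2r mulnC ltn_mul2l r_gt0.
Qed.

(** The walk [H] falls by 1 at each spot and rises by [r] at each occupied one, so it loses [k] per
    turn. Reading the circle from [z], the height condition becomes [H (z + N) < H (z + t)] with
    [N = q.+2], which the cycle lemma counts. *)
Lemma sum_bounded_rotations (k r q : nat) (s : seq 'I_q.+2) :
  (0 < r)%N -> q.+2 = (k + size s * r)%N -> uniq s ->
  (\sum_(z : 'I_q.+2)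
    bounded k r (map (@label q.+2) (map (fun i => (i + z)%R) s)))%N = k.
Proof.
move=> r_gt0 def_n uniq_s.
pose occ t : nat := (t%:R : 'I_q.+2) \in s.
pose C t := (\sum_(0 <= j < t) occ j)%N.
pose H t : int := (r * C t)%:Z - t%:Z.
have countE (z t : 'I_q.+2) :
    count (fun i : 'I_q.+2 => i < t)%N (map (fun i => i - z) s)
      = (C (z + t) - C z)%N.
  rewrite /C (@big_cat_nat _ _ _ z) ?leq_addr //= addKn.
  rewrite -{1}[nat_of_ord z]add0n big_addn addKn big_mkord.
  rewrite (big_ord_widen q.+2 (fun j => occ (j + z)%N)) ?(ltnW (ltn_ord t)) //.
  rewrite count_map -sum1_count big_mkcond big_uniq // big_mkcond.
  rewrite [RHS]big_mkcond (reindex_inj (addIr z)); apply: eq_bigr => j _.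
  have -> : preim (fun i => i - z) (fun i : 'I_q.+2 => i < t)%N (j + z)
            = (j < t)%N by rewrite -{2}[j](addrK z).
  rewrite /occ natrD !natr_Zp.
  by case: (_ \in _); case: (_ < _)%N.
have C_mono i j : (i <= j)%N -> (C i <= C j)%N.
  by move=> le_ij; rewrite /C [leqRHS](@big_cat_nat _ _ _ i) //= leq_addr.
have C_period : C q.+2 = size s.
  rewrite /C big_mkord -(card_uniqP uniq_s) -sum1_card [RHS]big_mkcond.
  by apply: eq_bigr => i _; rewrite /occ natr_Zp; case: (_ \in _).
have C_shift t : C (t + q.+2)%N = (C t + size s)%N.
  rewrite -C_period addnC /C (@big_cat_nat _ _ _ q.+2) ?leq_addr //= addnC.
  congr addn; rewrite -{1}[q.+2]add0n big_addn addKn.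
  apply: eq_bigr => j _.
  by rewrite /occ natrD (pchar_Zp (isT : 1 < q.+2)%N : _ = 0 :> 'I_q.+2) addr0.
have H_step t : H t - 1 <= H t.+1.
  have := C_mono _ _ (leqnSn t); rewrite /H => le_C.
  have : (r * C t <= r * C t.+1)%N by rewrite leq_mul2l le_C orbT.
  by lia.
have H_shift t : H (t + q.+2)%N = H t - k%:Z.
  by rewrite /H C_shift mulnDr; move: def_n; rewrite mulnC; lia.
rewrite -[RHS](cycle_lemma (ltn0Sn q.+1) H_step H_shift).
(* Rotating by [- z] brings the spot [z] to 0, so the walk is read from [z]. *)
rewrite (reindex_inj oppr_inj); apply: eq_bigr => z _; congr nat_of_bool.
rewrite bounded_heights ?size_map //; apply: eq_forallb => t.
rewrite countE H_shift /H mulnBr.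
have : (r * C z <= r * C (z + t))%N by rewrite leq_mul2l C_mono ?orbT ?leq_addr.
by lia.
Qed.

(** * Parking on the circle *)

(** The circle is the ring of integers modulo [q.+2]; two successors make the ordinals a ring, in
    which [i%:R] wraps around. *)
Definition drive (q : nat) (c : bool) (s : 'I_q.+2) (i : nat) : 'I_q.+2 :=
  if c then s + i%:R else s - i%:R.

(** Step 0 is the preferred spot itself, so one search covers both a free and an occupied
    preference. *)
Definition circ_park_car (q : nat) (occ : seq 'I_q.+2) (s : 'I_q.+2)
    (c : bool) : 'I_q.+2 :=
  drive c s (find (fun i => drive c s i \notin occ) (iota 0 q.+2)).

Fixpoint circ_park (q : nat) (occ prefs : seq 'I_q.+2) (coins : seq bool) :
    seq 'I_q.+2 :=
  match prefs, coins with
  | s :: prefs', c :: coins' =>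
      let t := circ_park_car occ s c in t :: circ_park (t :: occ) prefs' coins'
  | _, _ => [::]
  end.

Lemma circ_park_car_shift q (occ : seq 'I_q.+2) s c z :
  circ_park_car (map (fun i => i + z) occ) (s + z) c
    = circ_park_car occ s c + z.
Proof.
have drive_shift i : drive c (s + z) i = drive c s i + z.
  by rewrite /drive; case: c; rewrite addrAC.
rewrite /circ_park_car drive_shift; congr (drive c s _ + z).
by apply: eq_find => i; rewrite drive_shift (mem_map (addIr z)).
Qed.

Lemma circ_park_shift q (occ prefs : seq 'I_q.+2) coins z :
  circ_park (map (fun i => i + z) occ) (map (fun i => i + z) prefs) coins
    = map (fun i => i + z) (circ_park occ prefs coins).
Proof.
elim: prefs occ coins => [|s prefs IH] occ [|c coins] //=.
by rewrite circ_park_car_shift -IH.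
Qed.

Lemma circ_park_car_free q (occ : seq 'I_q.+2) s c :
  s \notin occ -> circ_park_car occ s c = s.
Proof.
move=> free_s; have drive0 : drive c s 0 = s.
  by rewrite /drive mulr0n subr0 addr0 if_same.
by rewrite /circ_park_car /= drive0 free_s.
Qed.

Variant circ_park_car_spec q (occ : seq 'I_q.+2) (s : 'I_q.+2) (c : bool) :
    'I_q.+2 -> Type :=
  CircParkCarSpec i of drive c s i \notin occ
    & (forall j, (j < i)%N -> drive c s j \in occ) :
    circ_park_car_spec occ s c (drive c s i).

Lemma circ_park_carP q (occ : seq 'I_q.+2) s c f : f \notin occ ->
  circ_park_car_spec occ s c (circ_park_car occ s c).
Proof.
move=> free_f; set free := fun i => drive c s i \notin occ.
have has_free : has free (iota 0 q.+2).
  (* The witness is the number of steps from [s] to the free spot [f] in the direction of the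
     coin. *)
  apply/hasP; exists (nat_of_ord (if c then f - s else s - f)).
    by rewrite mem_iota leq0n add0n ltn_ord.
  rewrite /free /drive; case: c {free}; rewrite natr_Zp.
    by rewrite addrC subrK.
  by rewrite opprB addrC subrK.
rewrite /circ_park_car -/free; split.
  have := nth_find 0%N has_free; rewrite nth_iota //.
  by rewrite -{2}[q.+2](size_iota 0) -has_find.
move=> j lt_j; have := before_find 0%N lt_j; rewrite nth_iota.
  by move/negbFE.
by apply: ltn_trans lt_j _; rewrite -{2}[q.+2](size_iota 0) -has_find.
Qed.

Lemma exists_free_spot q (occ : seq 'I_q.+2) : (size occ < q.+2)%N ->
  exists f, f \notin occ.
Proof.
move=> small; apply/existsP; apply: contraTT small.
rewrite negb_exists -leqNgt => /forallP full.
rewrite -{1}[q.+2]card_ord (leq_trans _ (card_size occ)) //.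
by apply/subset_leq_card/subsetP => i _; apply: negbNE.
Qed.

Lemma circ_park_car_notin q (occ : seq 'I_q.+2) s c : (size occ < q.+2)%N ->
  circ_park_car occ s c \notin occ.
Proof. by case/exists_free_spot => f /circ_park_carP; case. Qed.

Lemma circ_park_uniq q (occ prefs : seq 'I_q.+2) coins :
  (size occ + size prefs <= q.+2)%N -> uniq occ ->
  uniq (circ_park occ prefs coins ++ occ).
Proof.
elim: prefs occ coins => [|s prefs IH] occ [|c coins] //= le_size uniq_occ.
set t := circ_park_car occ s c.
(* The new spot [t] is moved past the spots of the later cars, to join [occ]. *)
rewrite -[_ && _]/(uniq ([:: t] ++ _ ++ occ)) -uniq_catCA.
apply: IH => /=; first by rewrite addSnnS.
rewrite uniq_occ andbT circ_park_car_notin //.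
by apply: leq_trans le_size; rewrite addnS ltnS leq_addr.
Qed.

Lemma size_circ_park q (occ prefs : seq 'I_q.+2) coins :
  size coins = size prefs -> size (circ_park occ prefs coins) = size prefs.
Proof.
elim: prefs occ coins => [|s prefs IH] occ [|c coins] //= [eq_size].
by rewrite IH.
Qed.

(** * Weighted sums over all preferences on the circle *)

Definition displaced (q : nat) (prefs out : seq 'I_q.+2) : nat :=
  count (fun st => st.2 != st.1) (zip prefs out).

Lemma rep_cons2 s t prefs :
  rep (s :: t :: prefs) = ((t == s) + rep (t :: prefs))%N.
Proof.
rewrite /rep /= big_nat_recl //=; congr addn.
by apply: eq_big_nat => -[].
Qed.

Lemma sum_tuple_cons (V : nmodType) (T : finType) n (F : n.+1.-tuple T -> V) :
  \sum_(a : n.+1.-tuple T) F a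
    = \sum_(s : T) \sum_(a : n.-tuple T) F [tuple of s :: a].
Proof.
rewrite pair_bigA.
rewrite (reindex (fun sa : T * n.-tuple T => [tuple of sa.1 :: sa.2])) //.
exists (fun a => (thead a, [tuple of behead a])) => [[s a] _ | a _] /=.
  by congr (_, _); apply: val_inj.
by rewrite -tuple_eta.
Qed.

(** Induction on the number of cars left: the sum over the later cars depends on [occ] only through
    its size, so it factors out of the sum over the next preference. The previous preference [prev]
    is carried along to detect a repetition. *)
Lemma sum_circ_park_from (R : comRingType) q n (occ : seq 'I_q.+2) prev
    (coins : seq bool) (x y : R) :
  size coins = n -> (size occ + n <= q.+2)%N -> uniq occ -> prev \in occ ->
  \sum_(a : n.-tuple 'I_q.+2)
    x ^+ displaced a (circ_park occ a coins)
      * y ^+ rep (map (@label _) (prev :: a))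
  = \prod_(size occ <= j < size occ + n)
      (x * y + (j%:R - 1) * x + q.+2%:R - j%:R).
Proof.
elim: n occ prev coins => [|n IH] occ prev [|c coins] //= size_coins le_n.
  move=> _ _; rewrite addn0 big_geq // (big_pred1 [tuple]) => [|a]; last first.
    by rewrite [a]tuple0 /= eqxx.
  by rewrite /rep /= big_geq // mulr1.
move=> uniq_occ prev_occ.
have lt_occ : (size occ < q.+2)%N.
  by apply: leq_trans le_n; rewrite addnS ltnS leq_addr.
set W := \prod_((size occ).+1 <= j < size occ + n.+1)
  (x * y + (j%:R - 1) * x + q.+2%:R - j%:R).
have weight s : \sum_(a : n.-tuple 'I_q.+2)
    x ^+ displaced [tuple of s :: a]
           (circ_park occ [tuple of s :: a] (c :: coins))
      * y ^+ rep (map (@label _) [:: prev, s & a])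
    = x ^+ (s \in occ) * y ^+ (s == prev) * W.
  set t := circ_park_car occ s c.
  (* The invariant for the next car: the preference [s] is now taken, by this car or an earlier
     one. *)
  have s_in : s \in t :: occ.
    rewrite inE; case: (boolP (s \in occ)) => [|/circ_park_car_free tE].
      by rewrite orbT.
    by rewrite /t tE eqxx.
  rewrite /W -addSnnS -[(size occ).+1]/(size (t :: occ)) -(IH _ s coins) //;
    last first.
  - by rewrite /= uniq_occ circ_park_car_notin.
  - by rewrite /= addSnnS.
  - by case: size_coins.
  rewrite mulr_sumr; apply: eq_bigr => a _.
  rewrite /displaced /= rep_cons2 /label eqSS -/t.
  have -> : (t != s) = (s \in occ).
    case: (boolP (s \in occ)) => [s_occ|/circ_park_car_free tE].
      by apply: contraTneq s_occ => <-; apply: circ_park_car_notin.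
    by rewrite /t tE eqxx.
  by rewrite !exprD -!mulrA; congr (_ * _); rewrite mulrCA.
rewrite sum_tuple_cons.
rewrite (eq_bigr _ (fun s _ => weight s)).
rewrite -mulr_suml [RHS]big_ltn; last by rewrite addnS ltnS leq_addr.
rewrite -/W; congr (_ * _).
(* As [prev] is occupied, the weight is linear in the two indicators, whose sums are [size occ] and
   1. *)
transitivity (\sum_s
  (1 + (s \in occ)%:R * (x - 1) + (s == prev)%:R * (x * y - x))).
  apply: eq_bigr => s _; case: (eqVneq s prev) => [->|_].
    by rewrite prev_occ /=; ring.
  by case: (s \in occ) => /=; ring.
rewrite !big_split /= -!mulr_suml -!natr_sum sumr_const card_ord.
rewrite -[X in X%:R * (x - 1)]big_mkcond sum1_card (card_uniqP uniq_occ).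
rewrite -[X in X%:R * (x * y - x)]big_mkcond big_pred1_eq.
by ring.
Qed.

(** The first car always gets its preference: it contributes the factor [q.+2] and serves as the
    initial [prev]. *)
Lemma sum_circ_park (R : comRingType) q n (coins : seq bool) (x y : R) :
  size coins = n.+1 -> (n < q.+2)%N ->
  \sum_(a : n.+1.-tuple 'I_q.+2)
    x ^+ displaced a (circ_park [::] a coins) * y ^+ rep (map (@label _) a)
  = q.+2%:R * \prod_(1 <= j < n.+1)
      (x * y + (j%:R - 1) * x + q.+2%:R - j%:R).
Proof.
case: coins => // c coins [size_coins] lt_n; rewrite sum_tuple_cons.
set P := \prod_(_ <= j < _) _.
transitivity (\sum_(s : 'I_q.+2) P); last first.
  by rewrite sumr_const card_ord mulr_natl.
apply: eq_bigr => s _; rewrite /P.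
rewrite -(@sum_circ_park_from _ q n [:: s] s coins x y) ?mem_head //.
by apply: eq_bigr => a _; rewrite /displaced /= circ_park_car_free // eqxx.
Qed.

Lemma displaced_map q (g : 'I_q.+2 -> 'I_q.+2) prefs out : injective g ->
  displaced (map g prefs) (map g out) = displaced prefs out.
Proof.
move=> inj_g; rewrite /displaced.
elim: prefs out => [|s prefs IH] [|t out] //=.
by rewrite IH (inj_eq inj_g).
Qed.

Lemma rep_map_label q (g : 'I_q.+2 -> 'I_q.+2) prefs : injective g ->
  rep (map (@label _) (map g prefs)) = rep (map (@label _) prefs).
Proof.
move=> inj_g; elim: prefs => [|s [|t prefs] IH] //=.
  by rewrite /rep /= !big_geq.
rewrite !rep_cons2 IH; congr (nat_of_bool _ + _)%N.
by rewrite /label !eqSS !(inj_eq val_inj) (inj_eq inj_g).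
Qed.

(** Averaging over rotations: after multiplication by [q.+2], the sum is taken over all rotations of
    each preference list. The weight is invariant, and [k] rotations of the occupied set are
    bounded. *)
Lemma sum_circ_park_bounded (R : numFieldType) k r q n
    (coins : seq bool) (x y : R) :
  (0 < r)%N -> q.+2 = (k + n.+1 * r)%N -> size coins = n.+1 ->
  \sum_(a : n.+1.-tuple 'I_q.+2)
    x ^+ displaced a (circ_park [::] a coins) * y ^+ rep (map (@label _) a)
      * (bounded k r (map (@label _) (circ_park [::] a coins)))%:R
  = k%:R * \prod_(1 <= j < n.+1)
      (x * y + (j%:R - 1) * x + q.+2%:R - j%:R).
Proof.
move=> r_gt0 def_q size_coins.
have lt_n : (n < q.+2)%N.
  by rewrite def_q (leq_trans (leq_pmulr n.+1 r_gt0)) ?leq_addl.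
have q_neq0 : q.+2%:R != 0 :> R by rewrite pnatr_eq0.
apply: (mulfI q_neq0); rewrite mulrCA -(sum_circ_park x y size_coins lt_n).
set S := \sum_(a : _) _.
transitivity (\sum_(z : 'I_q.+2) S).
  by rewrite sumr_const card_ord mulr_natl.
rewrite mulr_sumr.
pose shift z (a : n.+1.-tuple 'I_q.+2) := map_tuple (fun i => i + z) a.
have shift_inj z : injective (shift z).
  by move=> a b /(congr1 val) /= /(inj_map (addIr z)) /val_inj.
transitivity (\sum_(z : 'I_q.+2) \sum_(a : n.+1.-tuple 'I_q.+2)
    x ^+ displaced a (circ_park [::] a coins) * y ^+ rep (map (@label _) a)
    * (bounded k r (map (@label _)
         (map (fun i => i + z) (circ_park [::] a coins))))%:R).
  apply: eq_bigr => z _; rewrite /S (reindex_inj (shift_inj z)) /=.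
  apply: eq_bigr => a _; rewrite (circ_park_shift [::]).
  by rewrite displaced_map ?rep_map_label //; apply: addIr.
rewrite exchange_big; apply: eq_bigr => a _ /=.
rewrite -mulr_sumr mulrC -natr_sum sum_bounded_rotations //.
  by rewrite size_circ_park size_tuple.
have := @circ_park_uniq q [::] a coins; rewrite cats0; apply => //.
by rewrite add0n size_tuple.
Qed.

(** * Comparison of the street with the circle *)

Lemma ohead_filter_cat (T : eqType) (P : pred T) s1 b s2 :
  ~~ has P s1 -> P b -> ohead [seq t <- s1 ++ b :: s2 | P t] = Some b.
Proof. by rewrite has_filter negbK filter_cat => /eqP -> /= ->. Qed.

Lemma iota1_split n b : (b < n)%N ->
  iota 1 n = iota 1 b ++ b.+1 :: iota b.+2 (n - b.+1).
Proof. by move=> lt_b; rewrite -{1}(subnKC lt_b) addSnnS iotaD. Qed.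

(* The spots from n on lie outside the street; the last one is never occupied
   by a car of the street, so the search on the circle stops there at the
   latest, in either direction. *)
Lemma park_car_circ q n (occ : seq 'I_q.+2) (s : 'I_q.+2) c :
  (n < q.+2)%N -> all (fun i : 'I_q.+2 => i < n)%N occ -> (s < n)%N ->
  park_car n (map (@label _) occ) (label s) c
    = let t := circ_park_car occ s c in
      if (t < n)%N then Some (label t) else None.
Proof.
move=> lt_nq /allP occ_n lt_sn.
have mem_label i : (label i \in map (@label _) occ) = (i \in occ).
  by rewrite mem_map // => j l [/val_inj].
have max_free : ord_max \notin occ.
  by apply/negP => /occ_n /=; lia.
rewrite /park_car mem_label; case: ifPn => [free_s|].
  by rewrite circ_park_car_free //= lt_sn.
rewrite negbK => s_occ /=.
case: (circ_park_carP s c max_free) => i; rewrite /drive.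
case: c => [|] free_i occ_lt.
  (* Going forward, the free spot [ord_max] stops the search before it wraps, so the sum is one of
     natural numbers. *)
  have le_i : (s + i <= q.+1)%N.
    have [//|lt_i] := leqP (s + i) q.+1.
    have /occ_lt : (q.+1 - s < i)%N by lia.
    suff -> : s + (q.+1 - s)%:R = ord_max by rewrite (negPf max_free).
    apply: val_inj; rewrite Zp_nat /= modnDmr subnKC ?modn_small //.
    by rewrite -ltnS.
  have val_drive j : (j <= i)%N -> (s + j%:R : 'I_q.+2) = (s + j)%N :> nat.
    by move=> le_j; rewrite Zp_nat /= modnDmr modn_small //; lia.
  have i_gt0 : (0 < i)%N.
    by case: i free_i {occ_lt le_i val_drive} => //; rewrite addr0 s_occ.
  have none_before t : (t < (s + i).+1)%N ->
      ~~ ((label s < t) && (t \notin map (@label _) occ))%N.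
    move=> lt_t; rewrite negb_and negbK -leqNgt; case: leqP => //= lt_st.
    (* Label [t] is the spot [t - 1], reached from [s] after [t - s.+1] steps. *)
    have /occ_lt : (t - s.+1 < i)%N by move: lt_st; rewrite /label; lia.
    rewrite -mem_label /label val_drive; last by lia.
    by rewrite -addSn subnKC //; exact: ltnW lt_st.
  rewrite val_drive // /first_larger; case: ifP => [lt_n|/negbT].
    rewrite (iota1_split lt_n) ohead_filter_cat /label ?val_drive //.
      apply/hasPn => t; rewrite mem_iota => /andP[_ lt_t].
      by apply: none_before; lia.
    rewrite ltnS -addn1 leq_add2l i_gt0 /=.
    by rewrite -(val_drive i (leqnn i)) -[_.+1]/(label _) mem_label.
  rewrite -leqNgt => le_n; apply/eqP; case E: [seq _ <- _ | _] => [|t l] //.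
  have : t \in [seq t <- iota 1 n |
                    (label s < t)%N && (t \notin map (@label _) occ)].
    by rewrite E mem_head.
  rewrite mem_filter mem_iota => /andP[P_t lt_t].
  have /none_before : (t < (s + i).+1)%N by lia.
  by rewrite P_t.
have val_drive j : (j <= s)%N -> (s - j%:R : 'I_q.+2) = (s - j)%N :> nat.
  move=> le_j; rewrite -{1}[s]natr_Zp -natrB // Zp_nat /= modn_small //.
  by move: (ltn_ord s); lia.
(* Going backwards, step [s.+1] crosses from spot 0 to the free [ord_max], so the search ends there
   at the latest. *)
have wrap : s - s.+1%:R = ord_max :> 'I_q.+2.
  rewrite -natr1 natr_Zp opprD addrA subrr add0r; apply: val_inj => /=.
  by rewrite !modn_small // subn1.
have le_i : (i <= s.+1)%N.
  by rewrite leqNgt; apply/negP => /occ_lt; rewrite wrap (negPf max_free).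
have i_gt0 : (0 < i)%N.
  by case: i free_i {occ_lt le_i} => //; rewrite subr0 s_occ.
have none_between t : (0 < t)%N -> (s.+1 < t + i)%N ->
    ~~ ((t < label s) && (t \notin map (@label _) occ))%N.
  move=> t_gt0 lt_t; rewrite negb_and negbK -leqNgt; case: leqP => //= lt_ts.
  have /occ_lt : (s.+1 - t < i)%N by lia.
  rewrite -mem_label /label val_drive; last by move: lt_ts; rewrite /label; lia.
  suff -> : (s - (s.+1 - t)).+1 = t by [].
  by move: lt_ts; rewrite /label; lia.
(* The case [i = s.+1] is failure on the street; for [i <= s] the car parks without wrapping. *)
rewrite /first_smaller; move: le_i; rewrite leq_eqVlt => /orP[/eqP def_i|].
  rewrite def_i wrap /= ltnNge -ltnS lt_nq /=.
  case E: [seq _ <- _ | _] => [|t l] //.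
  have : t \in [seq t <- rev (iota 1 n) |
                  (t < label s)%N && (t \notin map (@label _) occ)].
    by rewrite E mem_head.
  rewrite mem_filter mem_rev mem_iota => /andP[P_t lt_t].
  by have := none_between t; rewrite P_t; lia.
rewrite ltnS => le_is; rewrite val_drive // ifT; last by lia.
have lt_n : (s - i < n)%N by lia.
rewrite (iota1_split lt_n) rev_cat rev_cons -cats1 -catA /=.
rewrite ohead_filter_cat /label ?val_drive //.
  apply/hasPn => t; rewrite mem_rev mem_iota => lt_t.
  by apply: none_between; lia.
rewrite -(val_drive i le_is) -[X in X \notin _]/(label _) mem_label.
rewrite free_i andbT.
by rewrite val_drive //; lia.
Qed.

(** The two processes agree until a car on the circle lands at [n] or beyond. This happens exactly
    when its preference is off the street or it fails to park there. *)
Lemma park_circ q n (occ prefs : seq 'I_q.+2) coins :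
  (n < q.+2)%N -> size coins = size prefs ->
  all (fun i : 'I_q.+2 => i < n)%N occ ->
  let out := park n (map (@label _) occ) (map (@label _) prefs) coins in
  let circ := circ_park occ prefs coins in
  all (fun i : 'I_q.+2 => i < n)%N circ
    = all (fun i : 'I_q.+2 => i < n)%N prefs && all isSome out
  /\ (all (fun i : 'I_q.+2 => i < n)%N circ ->
      out = map (fun i => Some (label i)) circ).
Proof.
move=> lt_nq; elim: prefs occ coins => [|s prefs IH] occ [|c coins] //=.
move=> [eq_size] occ_n; have [lt_sn|le_ns] := ltnP s n; last first.
  rewrite circ_park_car_free ?ltnNge ?le_ns //.
  by apply/negP => /(allP occ_n); rewrite ltnNge le_ns.
rewrite park_car_circ //=; case: ifP => [lt_tn|_] /=; last by rewrite andbF.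
have [|all_eq out_eq] := IH (circ_park_car occ s c :: occ) coins eq_size.
  by rewrite /= lt_tn.
rewrite all_eq; split => // /andP[pref_n out_some].
by rewrite out_eq // all_eq pref_n.
Qed.

(** The last inequality bounds the largest spot, hence every spot. *)
Lemma bounded_lt_u k r n (s : seq 'I_n) :
  bounded k r (map (@label n) s) ->
  all (fun i : 'I_n => i < u k r (size s))%N s.
Proof.
case: s => // a s /forallP bound; set s' := a :: s.
have lt_last : (size s < size (map (@label n) s'))%N by rewrite size_map.
have := bound (Ordinal lt_last); rewrite nth_sort_leq // count_map.
by move=> many; rewrite all_count eqn_leq count_size.
Qed.

(** A failure on the street puts a car of the circle at [n] or beyond, which [bounded] excludes;
    without failure both outcomes coincide. *)
Lemma eventV_circ k r q (prefs : seq 'I_q.+2) coins :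
  let n := u k r (size prefs) in
  let out := outcome n (map (@label _) prefs) coins in
  let circ := circ_park [::] prefs coins in
  (n < q.+2)%N -> size coins = size prefs ->
  all (fun i : 'I_q.+2 => i < n)%N prefs ->
  eventV k r out = bounded k r (map (@label _) circ) /\
  (eventV k r out -> unl (map (@label _) prefs) out = displaced prefs circ).
Proof.
move=> n out circ lt_nq size_coins prefs_n.
have [] := @park_circ q n [::] prefs coins lt_nq size_coins isT.
rewrite -[park _ _ _ _]/out -/circ prefs_n /= => circ_n out_eq.
have [lost|parked] := boolP (all isSome out); last first.
  rewrite /eventV (negPf parked); split=> //; symmetry; apply/negbTE.
  apply: contra parked => /bounded_lt_u.
  by rewrite -circ_n /circ size_circ_park.
have {}out_eq : out = map (fun i => Some (label i)) circ.
  by apply: out_eq; rewrite circ_n.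
have pmap_out : pmap id out = map (@label _) circ.
  by rewrite out_eq; elim: (circ) => //= i l ->.
split.
  by rewrite /eventV lost /occupied pmap_out out_eq /bounded !size_map.
move=> _; rewrite /unl /displaced out_eq.
elim: (prefs) (circ) => [|i l IH] [|j l'] //=.
by rewrite IH /label eqSS (inj_eq val_inj).
Qed.

(** * The sum on the street and the average over the coins *)

Lemma sum_park (R : numFieldType) k r m (coins : m.-tuple bool) (x y : R) :
  (0 < k)%N -> (0 < r)%N -> (0 < m)%N ->
  \sum_(a : m.-tuple 'I_(u k r m))
     x ^+ unl (labels a) (outcome (u k r m) (labels a) coins)
     * y ^+ rep (labels a)
     * (eventV k r (outcome (u k r m) (labels a) coins))%:R
  = k%:R * \prod_(1 <= i < m)
      (x * y + (i%:R - 1) * x + k%:R + m%:R * r%:R - i%:R).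
Proof.
move=> k_gt0 r_gt0; case: m coins => // m coins _; set n := u k r m.+1.
have [q def_q] : exists q, (k + m.+1 * r = q.+2)%N.
  by exists (k + m.+1 * r - 2)%N; nia.
have lt_nq : (n < q.+2)%N by rewrite -def_q /n /u /=; nia.
have n_gt0 : (0 < n)%N by rewrite ltn_addr.
under [in RHS]eq_bigr => i _ do
  rewrite -[_ + k%:R + _]addrA -natrM -natrD def_q.
rewrite -(sum_circ_park_bounded x y r_gt0 (esym def_q) (size_tuple coins)).
rewrite [RHS](bigID (fun a : m.+1.-tuple 'I_q.+2 =>
  all (fun i : 'I_q.+2 => i < n)%N a)) /=.
(* A preference off the street forces a car to park off it, so the occupied set is not bounded and
   the term vanishes. *)
rewrite [X in _ + X]big1 ?addr0 => [|a]; last first.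
  have eq_size : size coins = size a by rewrite !size_tuple.
  have [circ_n _] := @park_circ q n [::] a coins lt_nq eq_size isT.
  apply: contraNeq => neq0.
  have : bounded k r (map (@label _) (circ_park [::] a coins)).
    by apply: contraNT neq0 => /negPf ->; rewrite mulr0.
  move/bounded_lt_u; rewrite size_circ_park ?size_tuple //.
  by rewrite -/n circ_n => /andP[].
pose widen := map_tuple (widen_ord (ltnW lt_nq)) : m.+1.-tuple 'I_n -> _.
(* The default value of [insubd] is never taken: [narrow] is applied only to preferences below
   [n]. *)
pose narrow := map_tuple (fun i : 'I_q.+2 => insubd (Ordinal n_gt0) (i : nat)).
have widen_n (a : m.+1.-tuple 'I_n) :
    all (fun i : 'I_q.+2 => i < n)%N (widen a).
  by apply/allP => _ /mapP[i _ ->] /=.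
rewrite (reindex_onto widen (@narrow _)) => [|a /allP a_n]; last first.
  apply: val_inj; rewrite /= -map_comp map_id_in // => i /a_n lt_in.
  by apply: val_inj; rewrite /= insubdK.
apply: eq_big => [a | a _].
  rewrite widen_n /=; symmetry; apply/eqP/val_inj => /=.
  by rewrite -map_comp map_id_in // => i _; apply: (valKd (Ordinal n_gt0) i).
have -> : labels a = map (@label _) (widen a) by rewrite /= -map_comp.
have [] := @eventV_circ k r q (widen a) coins; rewrite ?size_tuple //.
move=> <-; case: eventV => [->|] //; by rewrite !mulr0.
Qed.

Lemma sum_coins_prob (R : realFieldType) m (p : R) :
  \sum_(c : m.-tuple bool) coins_prob p c = 1.
Proof.
elim: m => [|m IH].
  rewrite (big_pred1 [tuple]) => [|c]; first by rewrite /coins_prob big_ord0.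
  by rewrite [c]tuple0 /= eqxx.
transitivity (p * (\sum_(c : m.-tuple bool) coins_prob p c)
  + (1 - p) * (\sum_(c : m.-tuple bool) coins_prob p c)).
  rewrite sum_tuple_cons big_bool !mulr_sumr.
  congr (_ + _); apply: eq_bigr => c _; rewrite /coins_prob big_ord_recl tnth0;
    congr (_ * _); by apply: eq_bigr => i _; rewrite tnthS.
by rewrite IH !mulr1 addrC subrK.
Qed.

Theorem theorem3p4 (R : realFieldType) (k r m : nat)
  (hk : (0 < k)%N) (hr : (0 < r)%N) (hm : (0 < m)%N)
  (p : R) (hp : 0 <= p <= 1) (x y : R) :
  \sum_(a : m.-tuple 'I_(u k r m))
    expectation p (fun c : m.-tuple bool =>
      let out := outcome (u k r m) (labels a) c in
      x ^+ unl (labels a) out * y ^+ rep (labels a) * (eventV k r out)%:R)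
  = k%:R * \prod_(1 <= i < m)
      (x * y + (i%:R - 1) * x + k%:R + m%:R * r%:R - i%:R).
Proof.
(* With the coins fixed first, the inner sum has the same value for all of them, and their
   probabilities add up to 1. *)
rewrite exchange_big /=.
under eq_bigr => c _ do rewrite -mulr_sumr sum_park //.
by rewrite -mulr_suml sum_coins_prob mul1r.
Qed.
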